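(* Fix an even integer $\nu\ge4$, an integer $n\ge2$, and a real number $a>0$. Choose $$\frac1\nu<\gamma<\frac2\nu,\qquad R(q)=\begin{cases}q^{1+2/\nu}\sin(q^{-\gamma}),&q>0,\\ 0,&q\le0.\end{cases}$$ Then $R\in C^1(\mathbb R)$, $R(0)=R'(0)=0$, and on every compact $q$-set $K$ there is a constant $C_K$ with $$|R(r^\nu q)|\le C_Kr^{\nu+2}\qquad(q\in K,\ r>0).$$ Nevertheless, for every nonzero $c,d\in\mathbb R$, the family (with parameters $(a_0,a_1)\in\mathbb R^2$ near $(0,0)$) $$a_0+a_1q+cq^n+d\,\frac{2\nu}{\nu+1}a^{-1/\nu}q_+^{1+1/\nu}+R(q)$$ has unbounded local cyclicity at the origin.
   Context: $q_+=\max\{q,0\}$. Local cyclicity of a family $F(q,\lambda)$ at $(0,0)$: for an interval $U$ let $N_{\mathrm{iso}}(F(\cdot,\lambda);U)$ be the number of distinct isolated real zeros of $q\mapsto F(q,\lambda)$ in $U$; the cyclicity is $\inf_{\rho>0,\,V\ni0}\sup_{\lambda\in V}N_{\mathrm{iso}}(F(\cdot,\lambda);(-\rho,\rho))$, $V$ ranging over parameter neighbourhoods of $0$. ''Unbounded'' means this equals $\infty$: for every $\rho>0$, every neighbourhood $V$ of $(a_0,a_1)=(0,0)$ and every $N$ there is a parameter in $V$ with at least $N$ isolated zeros in $(-\rho,\rho)$. *)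

(* Defs.v *)
From mathcomp Require Import all_boot all_order all_algebra.
From mathcomp Require Import all_classical all_reals all_analysis.
Import Order.TTheory GRing.Theory Num.Theory.
Import numFieldNormedType.Exports.

Set Implicit Arguments.
Unset Strict Implicit.
Unset Printing Implicit Defensive.

Local Open Scope classical_set_scope.
Local Open Scope ring_scope.

(* [counting] is the cardinality, with value +oo on infinite sets. *)
Definition N_iso (R : realType) (f : R -> R) (U : set R) : \bar R :=
  counting (isolated [set q | f q = 0] `&` U).

Definition cyclicity (R : realType) (P : topologicalType)
    (F : R -> P -> R) (lam0 : P) : \bar R :=
  ereal_inf [set s : \bar R | exists (rho : R) (V : set P),
    [/\ 0 < rho, nbhs lam0 V &
        s = ereal_sup [set N_iso (fun q => F q lam) `](- rho), rho[
                        | lam in V]]].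

Definition class_C1 (R : realType) (f : R -> R) : Prop :=
  (forall q : R, derivable f q 1) /\ continuous (derive1 f).

Definition osc_remainder (R : realType) (nu : nat) (gamma : R) (q : R) : R :=
  if 0 < q then q `^ (1 + 2 / nu%:R) * sin (q `^ (- gamma)) else 0.

(* The parameter is the pair (a_0, a_1). *)
Definition perturbed_family (R : realType) (nu n : nat) (a gamma c d : R)
    (q : R) (lam : R * R) : R :=
  lam.1 + lam.2 * q + c * q ^+ n
  + d * ((2 * nu%:R) / (nu%:R + 1)) * a `^ (- (1 / nu%:R))
      * (Num.max q 0) `^ (1 + 1 / nu%:R)
  + osc_remainder nu gamma q.

(* Main.v *)
Require Import Defs.
From mathcomp Require Import all_boot all_order all_algebra.
From mathcomp Require Import all_classical all_reals all_analysis.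
From mathcomp Require Import finmap ring lra.
Import Order.TTheory GRing.Theory Num.Theory.
Import numFieldNormedType.Exports.

Local Open Scope classical_set_scope.
Local Open Scope ring_scope.

(** Write w = 2/nu and b = 1/nu, let D be the constant in front of
q_+^(1+b), and call S(q) = c q^n + D q^(1+b) the slow part of the family on
q > 0.  The remainder is a chirp: amplitude q^(1+w), phase q^(-gamma).

The claims on the remainder come from a single observation: differentiating
x^s sin(x^(-g)) produces x^(s-1) sin and x^(s-1-g) cos, again chirps, and a
chirp of positive exponent extends continuously by 0 across the origin
([chirp_continuous], [is_derive_chirp_sin]).  Here the worst exponent is
w - gamma > 0.

The slow part is much larger than the chirp, but over one period of the chirp
it hardly moves.  Near q the period in q is of order q^(1+gamma), so S drifts
by O(q^(b+1+gamma)), and this is o(q^(1+w)) because gamma > b = w - b.  Hence,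
for any N, if q_0 is small enough then S stays within half an amplitude of
S(q_0) during N consecutive half-periods.  Taking a_1 = 0 and a_0 = - S(q_0)
leaves the chirp plus an error of at most half its amplitude, and the
intermediate value theorem gives a zero in each half-period
([sin_perturbation_zero]).

At such a zero |sin| <= 1/2, hence |cos| >= 1/2, and the term
- gamma q^(w-gamma) cos(q^(-gamma)) of the derivative beats all others, again
because gamma > w - b ([chirp_slope_neq0]).  So these zeros are simple, hence
isolated ([isolated_simple_zero]).  As q_0 tends to 0, both a_0 and the zeros
tend to 0 while N is arbitrary ([chirp_family_zeros]).

Everything is computed in the phase variable t = q^(-gamma), in which the
half-periods are exactly the intervals [t + k pi, t + (k+1) pi] and
small q means large t. *)

(** * Comparison of powers *)

Lemma powR_dominated {R : realType} (K e s t : R) : t < s -> 0 < e ->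
  \forall q \near 0^'+, K * q `^ s < e * q `^ t.
Proof.
move=> ts e_gt0.
have small : \forall q \near 0^'+, K * q `^ (s - t) < e.
  apply: (cvgr_lt (K * 0)); last by rewrite mulr0.
  by apply: cvgM; [exact: cvg_cst|apply: powR_cvg0; rewrite subr_gt0].
near=> q.
have q_gt0 : 0 < q by near: q; exact: nbhs_right_gt.
rewrite -[s](subrK t) powRD; last by rewrite (gt_eqF q_gt0) implybT.
rewrite mulrA ltr_pM2r ?powR_gt0//.
by near: q.
Unshelve. all: by end_near. Qed.

Lemma near_pinfty_inv {R : realType} (P : R -> Prop) :
  (\forall q \near 0^'+, P q) -> \forall t \near +oo, P t^-1.
Proof.
move=> [e /= e_gt0 eP]; near=> t.
have t_gt0 : 0 < t by near: t; apply: nbhs_pinfty_gt; exact: num_real.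
apply: eP; last by rewrite invr_gt0.
rewrite /ball_/= sub0r normrN gtr0_norm ?invr_gt0// invf_plt ?posrE//.
by near: t; apply: nbhs_pinfty_gt; exact: num_real.
Unshelve. all: by end_near. Qed.

Lemma powR_dominated_pinfty {R : realType} (K e s t : R) : s < t -> 0 < e ->
  \forall x \near +oo, K * x `^ s < e * x `^ t.
Proof.
move=> st e_gt0; near=> x.
have x_gt0 : 0 < x by near: x; apply: nbhs_pinfty_gt; exact: num_real.
have invE u : x^-1 `^ (- u) = x `^ u.
  by rewrite -powR_inv1 ?ltW// -powRrM mulN1r opprK.
rewrite -(invE s) -(invE t).
near: x.
apply: (near_pinfty_inv (fun q => K * q `^ (- s) < e * q `^ (- t))).
by apply: powR_dominated; rewrite ?ltrN2.
Unshelve. all: by end_near. Qed.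

Lemma powRN_antitone {R : realType} (s x y : R) :
  0 <= s -> 0 < x -> x <= y -> y `^ (- s) <= x `^ (- s).
Proof.
move=> s_ge0 x_gt0 xy; have y_gt0 := lt_le_trans x_gt0 xy.
rewrite !powRN lef_pV2 ?posrE ?powR_gt0//.
by rewrite ge0_ler_powR ?nnegrE// ltW.
Qed.

Lemma powRN_lipschitz {R : realType} (p x y : R) : 0 < p -> 0 < x -> x <= y ->
  `|y `^ (- p) - x `^ (- p)| <= p * x `^ (- p - 1) * (y - x).
Proof.
move=> p_gt0 x_gt0 xy.
have gt0 z : z \in `[x, y] -> 0 < z.
  by rewrite in_itv/= => /andP[xz _]; exact: lt_le_trans xz.
have der z : z \in `[x, y] ->
    is_derive z 1 (@powR R ^~ (- p)) (- p * z `^ (- p - 1)).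
  by move=> /gt0 z_gt0; exact: is_derive1_powR.
have [z zxy ->] : exists2 z, z \in `[x, y] &
    y `^ (- p) - x `^ (- p) = - p * z `^ (- p - 1) * (y - x).
  have MVTp := @MVT_segment R (fun z => z `^ (- p))
    (fun z => - p * z `^ (- p - 1)) x y xy.
  have /MVTp : forall z, z \in `]x, y[%R ->
      is_derive z 1 (fun z : R => z `^ (- p)) (- p * z `^ (- p - 1)).
    by move=> z zxy; apply: der; apply: subset_itv_oo_cc zxy.
  have cont : {within `[x, y], continuous (fun z : R => z `^ (- p))}.
    by apply: derivable_within_continuous => z /der dz; exact: ex_derive.
  by move=> /(_ cont).
rewrite !normrM normrN (gtr0_norm p_gt0) (ger0_norm (powR_ge0 _ _)).
rewrite ger0_norm ?subr_ge0// ler_wpM2r ?subr_ge0// (ler_wpM2l (ltW p_gt0))//.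
have z_gt0 := gt0 _ zxy; move: zxy; rewrite in_itv/= => /andP[xz _].
have -> : - p - 1 = - (p + 1) by ring.
by apply: powRN_antitone => //; rewrite addr_ge0// ltW.
Qed.

(** A power t^(-p) varies over a window of fixed length L by O(t^(-p-1)), one
order less than its size; this is why it can be absorbed into t^(-s) even for
some s larger than p. *)
Lemma powRN_slow {R : realType} (K e p s L : R) :
  0 < p -> s < p + 1 -> 0 < e -> 0 < s ->
  \forall t \near +oo, forall x, t <= x <= t + L ->
    `|K * (x `^ (- p) - t `^ (- p))| <= e * x `^ (- s).
Proof.
move=> p_gt0 sp e_gt0 s_gt0; near=> t => x /andP[tx xL].
have t_gt0 : 0 < t by near: t; apply: nbhs_pinfty_gt; exact: num_real.
have x_gt0 : 0 < x by exact: lt_le_trans tx.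
have x2t : x <= 2 * t.
  apply: (le_trans xL); rewrite mulrC mulr_natr mulr2n lerD2l.
  by near: t; apply: nbhs_pinfty_ge; exact: num_real.
have xtL : x - t <= `|L| by rewrite lerBlDl (le_trans xL)// lerD2l ler_norm.
(* x <= 2 t, so t^(-s) is comparable to x^(-s) on the whole window. *)
apply: (@le_trans _ _ (e * 2 `^ (- s) * t `^ (- s))).
  rewrite normrM; apply: le_trans; first apply: ler_wpM2l (normr_ge0 _) _ _ _.
    exact: powRN_lipschitz.
  apply: (@le_trans _ _ (`|K| * (p * t `^ (- p - 1) * `|L|))).
    by rewrite ler_wpM2l// ler_wpM2l// mulr_ge0 ?powR_ge0// ltW.
  have -> : `|K| * (p * t `^ (- p - 1) * `|L|) =
            (`|K| * p * `|L|) * t `^ (- p - 1) by ring.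
  apply: ltW; near: t; apply: powR_dominated_pinfty.
    by rewrite -opprD ltrN2.
  by rewrite mulr_gt0// powR_gt0.
rewrite -mulrA (ler_wpM2l (ltW e_gt0))// -powRM ?(ltW t_gt0)//.
exact: powRN_antitone (ltW s_gt0) x_gt0 x2t.
Unshelve. all: by end_near. Qed.

(** * Zeros, their isolation and their number *)

(** From an extremum of sin to the next one sin runs from one of 1, -1 to the
other, and an error of at most 1/2 cannot change these signs. *)
Lemma sin_perturbation_zero {R : realType} (E : R -> R) (t : R) :
  `|sin t| = 1 -> {within `[t, t + pi], continuous E} ->
  (forall x, x \in `[t, t + pi] -> `|E x| <= 1 / 2) ->
  exists2 x, x \in `]t, t + pi[ & sin x + E x = 0.
Proof.
move=> sin1 cE E_small.
have pi_gt0 := pi_gt0 R.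
have tpi : t <= t + pi by rewrite lerDl ltW.
have /E_small : t \in `[t, t + pi] by rewrite in_itv/= lexx tpi.
have /E_small : t + pi \in `[t, t + pi] by rewrite in_itv/= lexx tpi.
rewrite !ler_norml => /andP[E1 E2] /andP[E3 E4].
have sinpi : sin (t + pi) = - sin t by rewrite sinDpi.
have sinE : sin t = 1 \/ sin t = - 1.
  by move/eqP: sin1; rewrite eqr_norml ler01 andbT => /orP[]/eqP; [left|right].
have [||x] := @IVT R (fun x => sin x + E x) t (t + pi) 0 tpi.
- move=> x; apply: cvgD (cE x); apply: continuous_subspaceT.
  exact: continuous_sin.
- rewrite sinpi ge_min le_max; case: sinE => ->; apply/andP; split; apply/orP;
    try (by left; lra); by right; lra.
rewrite in_itv/= => /andP[tx xt] x0; exists x => //.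
rewrite in_itv/= !lt_neqAle tx xt !andbT; apply/andP; split; apply/eqP => xE.
  by move: x0; rewrite -xE; case: sinE => ->; lra.
by move: x0; rewrite xE sinpi; case: sinE => ->; lra.
Qed.

Lemma isolated_simple_zero {R : realType} (f : R -> R) (x l : R) :
  f x = 0 -> is_derive x 1 f l -> l != 0 -> isolated [set y | f y = 0] x.
Proof.
move=> fx0 [df dfl] l0; split; first exact/mem_set.
exists [set y | y = x \/ f y != 0]; last first.
  apply/seteqP; split=> [y [[//|/eqP fy0] fy]|y ->]; first by have := fy0 fy.
  by split; [left|].
have : (fun h => h^-1 *: ((f \o shift x) (h *: 1) - f x)) @ 0^' --> l.
  by rewrite -dfl.
move=> /cvgr_neq0 /(_ l0); rewrite /dnbhs /within/= => nz.
apply/(@nbhs0P R R^o); near=> h.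
have [->|h0] := eqVneq h 0; first by left; rewrite addr0.
right; apply/eqP => fh.
suff: h^-1 *: ((f \o shift x) (h *: 1) - f x) != 0.
  by rewrite /= fx0 subr0 [h *: 1]mulr1 [h + x]addrC fh scaler0 eqxx.
by move: h0; near: h.
Unshelve. all: by end_near. Qed.

Lemma counting_ge_size {R : realType} {T : choiceType} (A : set T) (s : seq T) :
  uniq s -> {in s, forall x, A x} -> (((size s)%:R : R)%:E <= counting A)%E.
Proof.
move=> s_uniq sA; rewrite /counting; case: asboolP => finA; last exact: leey.
rewrite lee_fin ler_nat -(undup_id s_uniq) -card_fseq.
apply: fsubset_leq_card; apply/fsubsetP => x; rewrite inE/= => /sA Ax.
by rewrite in_fset_set//; exact: mem_set.
Qed.

(** The infimum over (rho, V) is +oo only if every supremum is, so the number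
of zeros has to be unbounded for each fixed pair. *)
Lemma cyclicity_infinite {R : realType} {P : topologicalType}
    (F : R -> P -> R) (lam0 : P) :
  (forall (rho : R) (V : set P) (N : nat), 0 < rho -> nbhs lam0 V ->
    exists2 lam, V lam &
      ((N%:R : R)%:E <= N_iso (fun q => F q lam) `](- rho)%R, rho[%classic)%E) ->
  cyclicity F lam0 = +oo%E.
Proof.
move=> many; apply/eqP; rewrite -leye_eq.
apply: le_ereal_inf_tmp => _ [rho [V [rho_gt0 V0 ->]]].
rewrite leye_eq; apply/eqP/eq_infty => t.
have [lam Vlam] := many rho V (Num.bound `|t|) rho_gt0 V0.
move=> /le_trans le_N; apply: (@le_trans _ _ (((Num.bound `|t|)%:R : R)%:E)).
  by rewrite lee_fin (le_trans (ler_norm t))// ltW// archi_boundP.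
by apply: le_N; apply: ereal_sup_ubound; exists lam.
Qed.

(** * Chirps *)

(** The oscillating factor f is a parameter because the derivative of a chirp
with f = sin involves one with f = cos. *)
Definition chirp {R : realType} (f : R -> R) (s g q : R) : R :=
  if 0 < q then q `^ s * f (q `^ (- g)) else 0.

Lemma chirp_gt0 {R : realType} (f : R -> R) (s g q : R) :
  0 < q -> chirp f s g q = q `^ s * f (q `^ (- g)).
Proof. by rewrite /chirp => ->. Qed.

Lemma chirp_le0 {R : realType} (f : R -> R) (s g q : R) :
  q <= 0 -> chirp f s g q = 0.
Proof. by rewrite /chirp ltNge => ->. Qed.

Lemma near_gt0_chirp {R : realType} (f : R -> R) (s g q : R) : 0 < q ->
  \forall x \near q, x `^ s * f (x `^ (- g)) = chirp f s g x.
Proof.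
move=> q_gt0; near=> x; rewrite chirp_gt0//.
by near: x; exact: lt_nbhsr.
Unshelve. all: by end_near. Qed.

Lemma near_lt0_chirp {R : realType} (f : R -> R) (s g q : R) : q < 0 ->
  \forall x \near q, 0 = chirp f s g x.
Proof.
move=> q_lt0; near=> x; rewrite chirp_le0// ltW//.
by near: x; exact: lt_nbhsl.
Unshelve. all: by end_near. Qed.

Lemma chirp_continuous {R : realType} (f : R -> R) (s g : R) : 0 < s ->
  continuous f -> (forall x, `|f x| <= 1) -> continuous (chirp f s g).
Proof.
move=> s_gt0 cf f1 q; have [q_lt0|q_gt0|->] := ltgtP q 0.
- rewrite /continuous_at chirp_le0 ?ltW//.
  apply: (@cvg_trans _ _ _ _ (near_eq_cvg (near_lt0_chirp f s g q q_lt0))).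
  exact: cvg_cst.
- rewrite /continuous_at chirp_gt0//.
  apply: (@cvg_trans _ _ _ _ (near_eq_cvg (near_gt0_chirp f s g q q_gt0))).
  have cpow u : {for q, continuous (fun x : R => x `^ u)}.
    apply/differentiable_continuous/derivable1_diffP.
    by apply: derivable_powR; rewrite in_itv/= q_gt0.
  apply: cvgM; first exact: cpow.
  exact: (continuous_comp (cpow (- g)) (cf _)).
- rewrite /continuous_at chirp_le0//; apply/cvgr0Pnorm_lt => e e_gt0.
  have := powR_dominated 1 e s 0 s_gt0 e_gt0.
  rewrite /at_right near_withinE/= => small.
  near=> x; have [x_le0|x_gt0] := leP x 0; first by rewrite chirp_le0// normr0.
  rewrite chirp_gt0// normrM ger0_norm ?powR_ge0//.
  apply: le_lt_trans (ler_piMr (powR_ge0 _ _) (f1 _)) _.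
  have : 0 < x -> 1 * x `^ s < e * x `^ 0 by near: x.
  by rewrite mul1r powRr0 mulr1; exact.
Unshelve. all: by end_near. Qed.

(** At the origin the difference quotient of a chirp of exponent s is the chirp
of exponent s - 1, which tends to 0; so the formula holds for every q. *)
Lemma is_derive_chirp_sin {R : realType} (s g q : R) : 1 < s ->
  is_derive q 1 (chirp sin s g)
    (s * chirp sin (s - 1) g q - g * chirp cos (s - 1 - g) g q).
Proof.
move=> s_gt1; have [q_lt0|q_gt0|->] := ltgtP q 0.
- rewrite !chirp_le0 ?ltW// !mulr0 subr0.
  exact: near_eq_is_derive (near_lt0_chirp sin s g q q_lt0)
    (is_derive_cst _ _ _).
- apply: near_eq_is_derive (near_gt0_chirp sin s g q q_gt0) _.
  have ds : is_derive q 1 (fun x : R => x `^ s) (s * q `^ (s - 1)).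
    exact: is_derive1_powR.
  have dg : is_derive q 1 (fun x : R => x `^ (- g)) (- g * q `^ (- g - 1)).
    exact: is_derive1_powR.
  have dsin := @is_derive1_comp R sin _ q _ _ (is_derive_sin _) dg.
  apply: is_derive_eq (is_deriveM ds dsin) _.
  rewrite !chirp_gt0// /GRing.scale/=.
  have -> : q `^ (s - 1 - g) = q `^ s * q `^ (- g - 1).
    rewrite -powRD; last by rewrite (gt_eqF q_gt0) implybT.
    by congr (_ `^ _); ring.
  by ring.
- rewrite !chirp_le0// !mulr0 subr0.
  have slope : (fun h => h^-1 *: ((chirp sin s g \o shift 0) (h *: 1) -
      chirp sin s g 0)) @ 0^' --> (0 : R).
    have c0 : chirp sin (s - 1) g x @[x --> 0^'] --> (0 : R).
      have c0 : continuous (chirp sin (s - 1) g).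
        apply: chirp_continuous; [by rewrite subr_gt0|exact: continuous_sin|].
        by move=> x; rewrite ler_norml sin_geN1 sin_le1.
      apply: cvg_within_filter; have := c0 0.
      by rewrite /continuous_at (chirp_le0 _ _ _ 0).
    apply: (@cvg_trans _ _ _ _ _ c0); apply: near_eq_cvg; near=> h.
    have h0 : h != 0 by near: h; exact: nbhs_dnbhs_neq.
    rewrite /= addr0 [h *: 1]mulr1 (chirp_le0 sin s g 0)// subr0.
    have [h_le0|h_gt0] := leP h 0; first by rewrite !chirp_le0// scaler0.
    rewrite !chirp_gt0// /GRing.scale/= mulrA; congr (_ * _).
    by rewrite -[in RHS](mulr_powRB1 (ltW h_gt0) (lt_trans ltr01 s_gt1)) mulKf.
  by apply: DeriveDef; [apply/cvg_ex; exists 0|apply/cvg_lim].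
Unshelve. all: by end_near. Qed.

Lemma class_C1_chirp_sin {R : realType} (s g : R) : 0 < g -> g + 1 < s ->
  class_C1 (chirp sin s g).
Proof.
move=> g_gt0 gs; have s_gt1 : 1 < s by apply: lt_trans gs; rewrite ltrDr.
split=> [q|]; first by case: (is_derive_chirp_sin s g q s_gt1).
have -> : derive1 (chirp sin s g) =
    (fun q => s * chirp sin (s - 1) g q - g * chirp cos (s - 1 - g) g q).
  apply/funext => q; rewrite derive1E.
  by case: (is_derive_chirp_sin s g q s_gt1).
move=> q; apply: cvgB; apply: cvgM; try exact: cvg_cst.
  apply: chirp_continuous; [by rewrite subr_gt0|exact: continuous_sin|].
  by move=> x; rewrite ler_norml sin_geN1 sin_le1.
apply: chirp_continuous; [by lra|exact: continuous_cos|].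
by move=> x; rewrite ler_norml cos_geN1 cos_le1.
Qed.

(** The amplitude is homogeneous: (r^nu q)^s = r^k q^s, and q^s is bounded on
K. *)
Lemma chirp_homogeneous_bound {R : realType} (f : R -> R) (nu k : nat)
    (s g : R) (K : set R) :
  (forall x, `|f x| <= 1) -> 0 < s -> nu%:R * s = k%:R -> compact K ->
  exists C : R, forall q r : R, K q -> 0 < r ->
    `|chirp f s g (r ^+ nu * q)| <= C * r ^+ k.
Proof.
move=> f1 s_gt0 sk /compact_bounded[M [_ KM]].
exists ((`|M| + 1) `^ s) => q r Kq r_gt0.
have rnu_gt0 : 0 < r ^+ nu by rewrite exprn_gt0.
have [q_le0|q_gt0] := leP q 0.
  rewrite chirp_le0 ?pmulr_rle0// normr0.
  by rewrite mulr_ge0 ?powR_ge0// exprn_ge0// ltW.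
rewrite chirp_gt0 ?mulr_gt0// normrM (ger0_norm (powR_ge0 _ _)).
apply: le_trans (ler_piMr (powR_ge0 _ _) (f1 _)) _.
rewrite powRM ?(ltW rnu_gt0) ?(ltW q_gt0)// mulrC.
rewrite -(powR_mulrn nu (ltW r_gt0)) -powRrM sk (powR_mulrn k (ltW r_gt0)).
rewrite ler_wpM2r ?exprn_ge0 ?(ltW r_gt0)//.
rewrite ge0_ler_powR ?nnegrE ?(ltW s_gt0) ?(ltW q_gt0) ?addr_ge0//.
have : `|q| <= `|M| + 1.
  by apply: KM => //; rewrite (le_lt_trans (ler_norm M))// ltrDl.
exact: le_trans (ler_norm q).
Qed.

(** * Many simple zeros *)

(** With S and C the sine and cosine of the phase, the sum is the derivative of
[chirp_family] below when a_1 = 0.  The cosine term has exponent w - g, smaller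
than w, than b and than n - 1, so it dominates as q tends to 0 as long as C
stays away from 0. *)
Lemma chirp_slope_neq0 {R : realType} (A B b w g : R) (n : nat) :
  0 < g -> (1 < n)%N -> w < 1 -> w < b + g ->
  \forall q \near 0^'+, forall S C, `|S| <= 1 -> 1 / 2 <= `|C| ->
    A * q ^+ n.-1 + B * q `^ b
      + ((1 + w) * (q `^ w * S) - g * (q `^ (w - g) * C)) != 0.
Proof.
move=> g_gt0 n_gt1 w_lt1 w_ltbg.
have small K u : w - g < u ->
    \forall x \near 0^'+, K * x `^ u < g / 8 * x `^ (w - g).
  by move=> wu; apply: powR_dominated => //; rewrite divr_gt0.
near=> q => S C S1 C_ge.
have q_gt0 : 0 < q by near: q; exact: nbhs_right_gt.
(* Three terms, each below g/8 q^(w-g), against one of at least g/2 q^(w-g). *)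
have A_lt : `|A| * q ^+ n.-1 < g / 8 * q `^ (w - g).
  rewrite -(powR_mulrn _ (ltW q_gt0)).
  near: q; apply: small; apply: (@lt_le_trans _ _ 1); first by lra.
  by rewrite ler1n -ltnS prednK// ltnW.
have B_lt : `|B| * q `^ b < g / 8 * q `^ (w - g) by near: q; apply: small; lra.
have S_lt : `|1 + w| * q `^ w < g / 8 * q `^ (w - g).
  by near: q; apply: small; lra.
set Q := q `^ (w - g) in A_lt B_lt S_lt *.
have Q_gt0 : 0 < Q by exact: powR_gt0.
have An : `|A * q ^+ n.-1| <= g / 8 * Q.
  by rewrite normrM (ger0_norm (exprn_ge0 _ (ltW q_gt0))) ltW.
have Bn : `|B * q `^ b| <= g / 8 * Q.
  by rewrite normrM (ger0_norm (powR_ge0 _ _)) ltW.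
have Sn : `|(1 + w) * (q `^ w * S)| <= g / 8 * Q.
  rewrite mulrA normrM; apply: le_trans (ler_piMr (normr_ge0 _) S1) _.
  by rewrite normrM (ger0_norm (powR_ge0 _ _)) ltW.
have Cn : g / 2 * Q <= `|g * (Q * C)|.
  rewrite !normrM (gtr0_norm g_gt0) (gtr0_norm Q_gt0).
  have : g * Q * (1 / 2) <= g * Q * `|C| by rewrite ler_wpM2l// mulr_ge0// ltW.
  by lra.
have gQ : 0 < g * Q by rewrite mulr_gt0.
apply/eqP => sum0.
have E : g * (Q * C) = A * q ^+ n.-1 + B * q `^ b + (1 + w) * (q `^ w * S).
  by lra.
have : `|g * (Q * C)| <= `|A * q ^+ n.-1| + `|B * q `^ b|
    + `|(1 + w) * (q `^ w * S)|.
  by rewrite E; apply: le_trans (ler_normD _ _) _; rewrite lerD2r ler_normD.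
by lra.
Unshelve. all: by end_near. Qed.

(** The exponents 1 + b and 1 + w are kept independent: what ties them together
is w < b + g, which says that the drift of q^(1+b) over one period of the
chirp is small compared with the amplitude q^(1+w). *)
Definition chirp_family {R : realType} (c D b w g : R) (n : nat)
    (q : R) (lam : R * R) : R :=
  lam.1 + lam.2 * q + c * q ^+ n + D * (Num.max q 0) `^ (1 + b)
    + chirp sin (1 + w) g q.

Lemma is_derive_chirp_family {R : realType} (c D b w g : R) (n : nat)
    (lam : R * R) (q : R) : 0 < q -> 0 < w ->
  is_derive q 1 (fun x => chirp_family c D b w g n x lam)
    (lam.2 + (c * n%:R * q ^+ n.-1 + D * (1 + b) * q `^ b
      + ((1 + w) * (q `^ w * sin (q `^ (- g)))
         - g * (q `^ (w - g) * cos (q `^ (- g)))))).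
Proof.
move=> q_gt0 w_gt0.
have near_max : \forall x \near q,
    lam.1 + lam.2 * x + c * x ^+ n + D * x `^ (1 + b) + chirp sin (1 + w) g x
    = chirp_family c D b w g n x lam.
  near=> x; rewrite /chirp_family; have -> // : Num.max x 0 = x.
  by apply/max_idPl/ltW; near: x; exact: lt_nbhsr.
apply: near_eq_is_derive near_max _.
have w1 : 1 < 1 + w by rewrite ltrDl.
have dchirp := is_derive_chirp_sin (1 + w) g q w1.
have dpow : is_derive q 1 (fun x : R => x `^ (1 + b))
  ((1 + b) * q `^ (1 + b - 1)) by exact: is_derive1_powR.
have did := @is_derive_id R R q 1.
have dcst k := @is_derive_cst R R R k q 1.
have dlin := is_deriveM (dcst lam.2) did.
have dn := is_deriveM (dcst c) (is_deriveX n did).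
have dD := is_deriveM (dcst D) dpow.
have dall := is_deriveD (is_deriveD (is_deriveD (is_deriveD (dcst lam.1) dlin)
  dn) dD) dchirp.
have -> : (fun x : R => lam.1 + lam.2 * x + c * x ^+ n + D * x `^ (1 + b)
    + chirp sin (1 + w) g x) = cst lam.1 + cst lam.2 * id
    + cst c * (id ^+ n) + cst D * (fun x => x `^ (1 + b))
    + chirp sin (1 + w) g.
  by apply/funext => x; rewrite !fctE.
apply: is_derive_eq dall _.
rewrite !chirp_gt0// /GRing.scale/=.
have -> : 1 + b - 1 = b by ring.
have -> : 1 + w - 1 = w by ring.
by ring.
Unshelve. all: by end_near. Qed.

Lemma near_pinfty_sin1 {R : realType} (P : R -> Prop) :
  (\forall t \near +oo, P t) -> exists2 t, P t & sin t = 1.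
Proof.
move=> [M [_ MP]]; pose m := Num.bound `|M|.
exists (pi / 2 + pi *+ 2 *+ m); last first.
  by rewrite (periodicn (@sinD2pi R)) sin_pihalf.
apply: MP; have pi_ge2 := pi_ge2 R.
have : M < m%:R by rewrite (le_lt_trans (ler_norm M))// archi_boundP.
rewrite -mulr_natr => Mm; have m_ge0 := ler0n R m.
have : 4 * m%:R <= pi *+ 2 * m%:R :> R by rewrite ler_wpM2r//; lra.
by lra.
Qed.

(** Subtracting the value of the slow part at a crest t of the chirp, far out
in the phase variable, leaves one zero in each of the N half-periods after t;
the coefficient a_1 can stay 0. *)
Lemma chirp_family_zeros {R : realType} (c D b w g : R) (n N : nat) (r : R) :
  0 < g -> (1 < n)%N -> 0 < b -> 0 < w -> w < 1 -> w < b + g -> 0 < r ->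
  exists2 a0 : R, `|a0| < r &
    exists2 s : seq R, uniq s /\ size s = N &
      {in s, forall q, 0 < q < r /\
        isolated [set x | chirp_family c D b w g n x (a0, 0) = 0] q}.
Proof.
move=> g_gt0 n_gt1 b_gt0 w_gt0 w_lt1 w_ltbg r_gt0.
(* With q = t^(-1/g): q^(1+w) = t^(-e), q^n = t^(-p1), q^(1+b) = t^(-p2). *)
pose e := (1 + w) / g; pose p1 := n%:R / g; pose p2 := (1 + b) / g.
have n_ge2 : 2 <= n%:R :> R by rewrite ler_nat.
have e_gt0 : 0 < e by rewrite divr_gt0//; lra.
have p1_gt0 : 0 < p1 by rewrite divr_gt0//; lra.
have p2_gt0 : 0 < p2 by rewrite divr_gt0//; lra.
have ep1 : e < p1 + 1.
  by rewrite /e ltr_pdivrMr// mulrDl mul1r divfK ?gt_eqF//; lra.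
have ep2 : e < p2 + 1.
  by rewrite /e ltr_pdivrMr// mulrDl mul1r divfK ?gt_eqF//; lra.
have quarter : 0 < 1 / 4 :> R by lra.
pose slow t := c * t `^ (- p1) + D * t `^ (- p2).
pose L : R := pi *+ N.
have [t [t_gt0 slow_small r_small dom window] sin1] : exists2 t,
    [/\ 0 < t, `|slow t| < r, t `^ (- g^-1) < r,
        forall x, t <= x -> forall S C, `|S| <= 1 -> 1 / 2 <= `|C| ->
          c * n%:R * x `^ (- g^-1) ^+ n.-1 + D * (1 + b) * x `^ (- g^-1) `^ b
            + ((1 + w) * (x `^ (- g^-1) `^ w * S)
               - g * (x `^ (- g^-1) `^ (w - g) * C)) != 0 &
        forall x, t <= x <= t + L ->
          `|slow x - slow t| <= 1 / 2 * x `^ (- e)] & sin t = 1.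
  have vanish K p u : 0 < p -> 0 < u ->
      \forall x \near +oo, K * x `^ (- p) < u :> R.
    move=> p_gt0 u_gt0; near=> x; rewrite -[u]mulr1 -(powRr0 x).
    by near: x; apply: powR_dominated_pinfty; rewrite ?oppr_lt0.
  have [u /= u_gt0 uP] := chirp_slope_neq0 (c * n%:R)
    (D * (1 + b)) b w g n g_gt0 n_gt1 w_lt1 w_ltbg.
  apply: near_pinfty_sin1; near=> t.
  have t_gt0 : 0 < t by near: t; apply: nbhs_pinfty_gt; exact: num_real.
  split=> //.
  - rewrite /slow; apply: le_lt_trans (ler_normD _ _) _.
    rewrite !normrM !(ger0_norm (powR_ge0 _ _)) [ltRHS]splitr.
    by apply: ltrD; near: t; apply: vanish => //; exact: divr_gt0.
  - by rewrite -[ltLHS]mul1r; near: t; apply: vanish => //; rewrite invr_gt0.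
  - move=> x tx; apply: uP; last by rewrite powR_gt0 ?(lt_le_trans t_gt0).
    rewrite /ball_/= sub0r normrN ger0_norm ?powR_ge0//.
    apply: (@le_lt_trans _ _ (t `^ (- g^-1))).
      by apply: powRN_antitone; rewrite ?invr_ge0 ?(ltW g_gt0).
    by rewrite -[ltLHS]mul1r; near: t; apply: vanish => //; rewrite invr_gt0.
  - move=> x txL.
    have c_slow : `|c * (x `^ (- p1) - t `^ (- p1))| <= 1 / 4 * x `^ (- e).
      by move: x txL; near: t; exact: powRN_slow.
    have D_slow : `|D * (x `^ (- p2) - t `^ (- p2))| <= 1 / 4 * x `^ (- e).
      by move: x txL {c_slow}; near: t; exact: powRN_slow.
    have -> : slow x - slow t = c * (x `^ (- p1) - t `^ (- p1))
        + D * (x `^ (- p2) - t `^ (- p2)) by rewrite /slow; ring.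
    by apply: le_trans (ler_normD _ _) _; lra.
have pi_gt0 := pi_gt0 R.
(* The family at x^(-1/g), divided by the chirp amplitude x^(-e), is
   sin x + E x. *)
pose E x := (slow x - slow t) * x `^ e.
have cE x : 0 < x -> {for x, continuous E}.
  move=> x_gt0.
  have cpow u : {for x, continuous (fun y : R => y `^ u)}.
    apply/differentiable_continuous/derivable1_diffP.
    by apply: derivable_powR; rewrite in_itv/= x_gt0.
  apply: cvgM; last exact: cpow.
  apply: cvgB; last exact: cvg_cst.
  by apply: cvgD; apply: cvgM; try exact: cvg_cst; exact: cpow.
have arch k : (k < N)%N -> exists x, (x \in `]t + pi *+ k, t + pi *+ k + pi[) /\
    (sin x + E x = 0 /\ `|E x| <= 1 / 2).
  move=> kN.
  have pik : 0 <= pi *+ k :> R by rewrite mulrn_wge0// ltW.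
  have pikL : pi *+ k + pi <= L.
    by rewrite -mulrSr /L (ler_wpMn2l (ltW pi_gt0)).
  have E_small x : x \in `[t + pi *+ k, t + pi *+ k + pi] -> `|E x| <= 1 / 2.
    rewrite in_itv/= => /andP[x1 x2].
    have x_gt0 : 0 < x by lra.
    rewrite /E normrM (ger0_norm (powR_ge0 _ _)).
    have := window x; rewrite powRN ler_pdivlMr ?powR_gt0//; apply.
    by apply/andP; split; lra.
  have [|||x xk x0] := sin_perturbation_zero E (t + pi *+ k).
  - have -> : sin (t + pi *+ k) = (- 1) ^+ k * sin t.
      by rewrite (alternatingn (@sinDpi R)).
    by rewrite sin1 mulr1 normrX normrN1 expr1n.
  - apply: continuous_in_subspaceT => x.
    by move=> /set_mem/=; rewrite in_itv/= => /andP[x1 _]; apply: cE; lra.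
  - exact: E_small.
  - exists x; split=> //; split=> //; apply: E_small.
    exact: subset_itv_oo_cc xk.
have /choice[z zP] : forall k, exists x, (k < N)%N ->
    (x \in `]t + pi *+ k, t + pi *+ k + pi[) /\
    (sin x + E x = 0 /\ `|E x| <= 1 / 2).
  move=> k; case: (ltnP k N) => [/arch[x xP]|_]; first by exists x.
  by exists 0.
have z_gt k : (k < N)%N -> t < z k.
  move=> /zP[+ _]; rewrite in_itv/= => /andP[+ _]; apply: le_lt_trans.
  by rewrite lerDl mulrn_wge0// ltW.
have z_gt0 k : (k < N)%N -> 0 < z k by move=> /z_gt; exact: lt_trans.
have z_lt j k : (j < k)%N -> (k < N)%N -> z j < z k.
  move=> jk kN; have [+ _] := zP _ (ltn_trans jk kN).
  have [+ _] := zP _ kN; rewrite !in_itv/= => /andP[zk _] /andP[_ zj].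
  apply: lt_trans zj _; apply: le_lt_trans zk.
  by rewrite -addrA -mulrSr lerD2l (ler_wpMn2l (ltW pi_gt0)).
pose q k := z k `^ (- g^-1).
have qK k : (k < N)%N -> q k `^ (- g) = z k.
  move=> kN; rewrite /q -powRrM mulrNN mulVf ?gt_eqF// powRr1// ltW//.
  exact: z_gt0.
have q_pow k u : q k `^ u = z k `^ (- (u / g)).
  by rewrite /q -powRrM mulNr mulrC.
exists (- slow t); first by rewrite normrN.
exists [seq q k | k <- iota 0 N].
  split; last by rewrite size_map size_iota.
  rewrite map_inj_in_uniq ?iota_uniq// => j k; rewrite !mem_iota !add0n /=.
  move=> jN kN /(congr1 (fun x => x `^ (- g))); rewrite !qK// => zjk.
  have [jk|kj|//] := ltngtP j k.
    by have := z_lt _ _ jk kN; rewrite zjk ltxx.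
  by have := z_lt _ _ kj jN; rewrite zjk ltxx.
move=> _ /mapP[k + ->]; rewrite mem_iota add0n /= => kN.
have zk_gt0 := z_gt0 _ kN; have [_ [zk0 Ek]] := zP _ kN.
have qk_gt0 : 0 < q k by exact: powR_gt0.
split.
  rewrite qk_gt0; apply: le_lt_trans r_small.
  by apply: powRN_antitone; rewrite ?invr_ge0 ?(ltW g_gt0)// ltW ?z_gt.
have der := is_derive_chirp_family c D b w g n (- slow t, 0) (q k) qk_gt0 w_gt0.
apply: isolated_simple_zero der _.
- rewrite /chirp_family /= chirp_gt0// qK// mul0r addr0.
  rewrite (max_idPl (ltW qk_gt0)) -(powR_mulrn _ (ltW qk_gt0)) !q_pow.
  rewrite -/p1 -/p2 -/e.
  have -> : sin (z k) = - E (z k) by lra.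
  rewrite /E mulrN mulrCA -powRD; last by rewrite (gt_eqF zk_gt0) implybT.
  by rewrite addNr powRr0 mulr1 /slow; ring.
- (* |sin| <= 1/2 at the zero, hence |cos| >= 1/2: the zero is simple. *)
  rewrite /= add0r qK//; apply: dom; first by rewrite ltW ?z_gt.
    by rewrite ler_norml sin_geN1 sin_le1.
  have : `|sin (z k)| <= 1 / 2.
    by rewrite (_ : sin (z k) = - E (z k)) ?normrN//; lra.
  move=> sin_small; rewrite leNgt; apply/negP => cos_small.
  have : `|cos (z k)| ^+ 2 + `|sin (z k)| ^+ 2 = 1.
    by rewrite !real_normK ?num_real// cos2Dsin2.
  have := normr_ge0 (cos (z k)); have := normr_ge0 (sin (z k)).
  by nra.
Unshelve. all: by end_near. Qed.

Theorem proposition7p3 (R : realType) (nu n : nat) (a gamma : R)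
    (nu_even : ~~ odd nu) (nu_ge4 : (4 <= nu)%N) (n_ge2 : (2 <= n)%N)
    (a_gt0 : 0 < a)
    (gamma_gt : 1 / nu%:R < gamma) (gamma_lt : gamma < 2 / nu%:R) :
  let Rem : R -> R := osc_remainder nu gamma in
  [/\ class_C1 Rem,
      Rem 0 = 0,
      derive1 Rem 0 = 0,
      forall K : set R, compact K ->
        exists C_K : R, forall q r : R, K q -> 0 < r ->
          `|Rem (r ^+ nu * q)| <= C_K * r ^+ (nu + 2) &
      forall c d : R, c != 0 -> d != 0 ->
        cyclicity (perturbed_family nu n a gamma c d) (0, 0) = +oo%E].
Proof.
move=> Rem.
have RemE : Rem = chirp sin (1 + 2 / nu%:R) gamma by [].
have nu_gt0 : 0 < nu%:R :> R by rewrite ltr0n (leq_trans _ nu_ge4).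
have b_gt0 : 0 < 1 / nu%:R :> R by rewrite divr_gt0.
have g_gt0 : 0 < gamma by exact: lt_trans gamma_gt.
have w_gt0 : 0 < 2 / nu%:R :> R by rewrite divr_gt0.
have w_lt1 : 2 / nu%:R < 1 :> R.
  by rewrite ltr_pdivrMr// mul1r ltr_nat (leq_trans _ nu_ge4).
have sin1 (x : R) : `|sin x| <= 1 by rewrite ler_norml sin_geN1 sin_le1.
split.
- by rewrite RemE; apply: class_C1_chirp_sin => //; lra.
- by rewrite RemE chirp_le0.
- rewrite RemE derive1E.
  have [|_ ->] := is_derive_chirp_sin (1 + 2 / nu%:R) gamma 0; first by lra.
  by rewrite !chirp_le0// !mulr0 subr0.
- move=> K; rewrite RemE; apply: chirp_homogeneous_bound => //.
  by rewrite mulrDr mulr1 mulrC divfK ?gt_eqF// natrD.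
move=> c d _ _; apply: cyclicity_infinite => rho V N rho_gt0 V0.
have [r /= r_gt0 rV] : exists2 r : R, 0 < r & forall x, `|x| < r -> V (x, 0).
  have /nbhs_ballP[r /= r_gt0 rV] := V0.
  exists r => // x xr; apply: rV; split; rewrite /= /ball/= sub0r normrN//.
  by rewrite normr0.
pose D := d * ((2 * nu%:R) / (nu%:R + 1)) * a `^ (- (1 / nu%:R)).
pose m := Num.min r rho.
have m_gt0 : 0 < m by rewrite lt_min r_gt0.
have w_ltbg : 2 / nu%:R < 1 / nu%:R + gamma by lra.
have [a0 a0m [s [s_uniq s_size] sP]] := chirp_family_zeros c D (1 / nu%:R)
  (2 / nu%:R) gamma n N m g_gt0 n_ge2 b_gt0 w_gt0 w_lt1 w_ltbg m_gt0.
exists (a0, 0); first by apply: rV; rewrite (lt_le_trans a0m)// ge_min lexx.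
rewrite /N_iso -s_size; apply: counting_ge_size => // x.
move=> /sP[/andP[x_gt0 xm] iso].
split; first exact: iso.
rewrite /= in_itv/= (lt_le_trans xm) ?andbT; last by rewrite ge_min lexx orbT.
by rewrite (lt_trans _ x_gt0)// oppr_lt0.
Qed.
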